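(* Let $G$ be a graph with $n$ vertices, $m\geq 1$ edges and $t(G)$ triangles. Then \[ \lambda_n(G)\geq \frac{2m^2-3n\,t(G)}{m(n^2-2m)}\,n, \] with equality if and only if $G$ is a regular complete multipartite graph, i.e. a complete $k$-partite graph for some $k\geq 2$ with all $k$ parts of equal size.
   Context: All graphs are finite, simple and undirected. $t(G)$ is the number of triangles in $G$. For a graph $G$ of order $n$, $L(G)=D(G)-A(G)$ is its Laplacian ($A(G)$ the adjacency matrix, $D(G)$ the diagonal degree matrix), with eigenvalues $0=\lambda_1(G)\leq\dots\leq\lambda_n(G)$; $\lambda_n(G)$ is the largest Laplacian eigenvalue. *)

(* Defs.v *)
From HB Require Import structures.
From mathcomp Require Import all_boot all_order all_algebra.
From mathcomp Require Import polyrcf.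
Set Implicit Arguments. Unset Strict Implicit. Unset Printing Implicit Defensive.
Import Order.TTheory GRing.Theory Num.Theory.
Local Open Scope ring_scope.

Definition simple_graph (n : nat) (e : rel 'I_n) : Prop :=
  symmetric e /\ irreflexive e.

Definition num_edges (n : nat) (e : rel 'I_n) : nat :=
  #|[set E : {set 'I_n} | [exists x, exists y, e x y && (E == [set x; y])]]|.

Definition num_triangles (n : nat) (e : rel 'I_n) : nat :=
  #|[set S : {set 'I_n} | (#|S| == 3)%N &&
       [forall x in S, forall y in S, (x != y) ==> e x y]]|.

Definition degree (n : nat) (e : rel 'I_n) (i : 'I_n) : nat :=
  #|[set k | e i k]|.

Definition adj_mx (R : nzRingType) (n : nat) (e : rel 'I_n) : 'M[R]_n :=
  \matrix_(i, j) (e i j)%:R.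
Definition deg_mx (R : nzRingType) (n : nat) (e : rel 'I_n) : 'M[R]_n :=
  \matrix_(i, j) (if i == j then (degree e i)%:R else 0).
Definition laplacian (R : nzRingType) (n : nat) (e : rel 'I_n) : 'M[R]_n :=
  deg_mx R e - adj_mx R e.

(* the largest Laplacian eigenvalue: the largest real root of the
   characteristic polynomial of L (L is real symmetric PSD, so all its
   eigenvalues are real and >= 0; the default 0 is itself an eigenvalue). *)
Definition lap_max (R : rcfType) (n : nat) (e : rel 'I_n) : R :=
  \big[Num.max/0]_(x <- rootsR (char_poly (laplacian R e))) x.

Definition regular_complete_multipartite (n : nat) (e : rel 'I_n) : Prop :=
  exists (k : nat) (f : 'I_n -> 'I_k),
    [/\ (2 <= k)%N,
        (forall i : 'I_k, (0 < #|[set x | f x == i]|)%N),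
        (forall i j : 'I_k, #|[set x | f x == i]| = #|[set x | f x == j]|) &
        (forall x y, e x y = (f x != f y))].

(* Main.v *)
(** For a vertex v of degree d_v let y_v be the indicator vector of the
    neighbourhood N(v), centred so as to be orthogonal to the all-ones vector,
    and let g_v >= 0 be the value at y_v of the positive semidefinite form
    lambda_n I - L. Counting edges and triangles, the g_v add up to
      lambda_n (2m - S/n) - (S - 6t),   where S is the sum of the d_v^2,
    so that, with V = S - 4m^2/n the sum of the squared deviations of the
    degrees from their mean,
      2 (lambda_n m (n^2 - 2m) - n (2m^2 - 3nt))
        = n^2 (sum of the g_v) + n V (lambda_n + n) >= 0.
    Equality means that the graph is regular and that every y_v is an
    eigenvector for lambda_n. The entry at v of the eigenvector equation gives
    lambda_n = n, and the entry at a vertex u not adjacent to v then gives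
    N(v) = N(u), so non-adjacency is an equivalence relation. *)
Require Import Defs.
From HB Require Import structures.
From mathcomp Require Import all_boot all_order all_algebra.
From mathcomp Require Import polyrcf complex spectral sesquilinear.
From mathcomp Require Import ring lra.
Import Order.TTheory GRing.Theory Num.Theory.
Local Open Scope ring_scope.

(** * Quadratic forms of real symmetric matrices *)

Lemma spectral_diag_eigenvalue {C : numClosedFieldType} {n} {A : 'M[C]_n} (i : 'I_n) :
  A \is normalmx -> eigenvalue A (spectral_diag A 0 i).
Proof.
move=> /orthomx_spectralP eqA; have Pu := spectral_unit A.
apply/eigenvalueP; exists (row i (spectralmx A)).
  rewrite [X in _ *m X = _]eqA -row_mul !mulmxA mulmxV // mul1mx.
  by apply/rowP => j; rewrite !mxE (bigD1 i) //= big1 ?addr0 => [|k ki];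
     rewrite !mxE ?eqxx ?mulr1n // eq_sym (negPf ki) mul0r.
apply/eqP => r0; have := row_mul i (spectralmx A) (invmx (spectralmx A)).
rewrite mulmxV // r0 mul0mx row1 => /rowP /(_ i).
by rewrite !mxE !eqxx => /eqP; rewrite oner_eq0.
Qed.

(** The spectral theorem is applied over [R[i]]: in a unitary eigenbasis the form is a sum of
    squared moduli weighted by the eigenvalues, each of which is at most [M]. *)
Lemma rayleigh_le {R : rcfType} {n} {A : 'M[R]_n} {M : R} :
    A^T = A -> (forall a, root (char_poly A) a -> a <= M) ->
  forall x : 'rV_n, (x *m A *m x^T) 0 0 <= M * (x *m x^T) 0 0.
Proof.
move=> symA rootM x; pose toC : R -> R[i] := real_complex R.
pose AC := map_mx toC A.
have realC m p (B : 'M[R]_(m, p)) : map_mx toC B \is a mxOver Num.real.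
  by apply/mxOverP => i j; rewrite mxE; apply/complex_realP; exists (B i j).
have hermA : AC \is hermsymmx.
  apply: realsym_hermsym; last exact: realC.
  by apply/is_hermitianmxP; rewrite expr0 scale1r map_mx_id // /AC map_trmx symA.
have nA := hermitian_normalmx hermA.
(* The diagonal entries are real because [AC] is hermitian, so each one is the image of a root in
   [R] of the characteristic polynomial of [A], where [rootM] applies. *)
have leM i : spectral_diag AC 0 i <= toC M.
  have /mxOverP/(_ 0 i)/complex_realP[d dE] := hermitian_spectral_diag_real hermA.
  have := spectral_diag_eigenvalue i nA; rewrite eigenvalue_root_char.
  rewrite /AC -map_char_poly dE fmorph_root => /rootM.
  by rewrite /toC lecR.
set P := spectralmx AC; have PU : P \is unitarymx := spectral_unitarymx _.
pose y := map_mx toC x *m invmx P.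
have yct : map_mx Num.conj y^T = P *m map_mx toC x^T.
  rewrite /y invmx_unitary // trmx_mul map_mxM trmxCK; congr (_ *m _).
  by rewrite map_trmx realmxC.
(* Stated for any matrix diagonalised by [P], so that [A] and the scalar matrix [M] become sums over
   the same coordinates [y] and can be compared term by term. *)
have main B (b : 'rV_n) : B = invmx P *m diag_mx b *m P ->
   (map_mx toC x *m B *m map_mx toC x^T) 0 0 = \sum_i b 0 i * (y 0 i * Num.conj (y 0 i)).
  move=> ->; rewrite !mulmxA -mulmxA -yct -/y mxE; apply: eq_bigr => i _.
  by rewrite mul_mx_diag !mxE; rewrite mulrAC mulrC.
have /main EA := @orthomx_spectralP _ _ AC nA.
have /main EM : (toC M)%:M = invmx P *m diag_mx (const_mx (toC M)) *m P.
  by rewrite diag_const_mx mul_mx_scalar -scalemxAl mulVmx ?spectral_unit // scalemx1.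
have toR B : (map_mx toC x *m map_mx toC B *m map_mx toC x^T) 0 0 =
    toC ((x *m B *m x^T) 0 0).
  by rewrite -!map_mxM mxE.
rewrite -lecR -!/(toC _) -toR EA.
have -> : M * (x *m x^T) 0 0 = (x *m M%:M *m x^T) 0 0.
  by rewrite mul_mx_scalar -scalemxAl [RHS]mxE.
rewrite -toR map_scalar_mx EM; apply: ler_sum => i _; rewrite [X in _ <= X * _]mxE.
by apply: ler_wpM2r; [exact: mul_conjC_ge0 | exact: leM].
Qed.

Lemma mulmx_tr_ge0 {R : realDomainType} {n} (z : 'rV[R]_n) : 0 <= (z *m z^T) 0 0.
Proof. by rewrite mxE sumr_ge0 // => i _; rewrite mxE -expr2 sqr_ge0. Qed.

Lemma mulmx_tr_eq0 {R : realDomainType} {n} (z : 'rV[R]_n) :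
  ((z *m z^T) 0 0 == 0) = (z == 0).
Proof.
apply/eqP/eqP => [|->]; last by rewrite mul0mx mxE.
rewrite mxE => /psumr_eq0P z0; apply/rowP => i; rewrite [RHS]mxE; apply/eqP.
have := z0 _ i isT; rewrite mxE -expr2 => z0i.
by rewrite -sqrf_eq0 z0i // => j _; rewrite mxE -expr2 sqr_ge0.
Qed.

Lemma perturbation_eq0 {R : realFieldType} (a b : R) : 0 <= a -> 0 <= b ->
  (forall s, 0 <= s ^+ 2 * b - 2 * s * a) -> a = 0.
Proof.
move=> a_ge0 b_ge0 /(_ (a / (b + 1))) ab; apply: contraTeq ab => a_neq0.
have a_gt0 : 0 < a by rewrite lt_def a_neq0.
rewrite -ltNge.
(* With [s = a / (b + 1)] one has [a = s * (b + 1)], so the value is negative unless [a = 0]. The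
   [+ 1] covers [b = 0]. *)
have -> : (a / (b + 1)) ^+ 2 * b - 2 * (a / (b + 1)) * a =
  - ((a / (b + 1)) ^+ 2 * (b + 2)) by field; lra.
by rewrite oppr_lt0 mulr_gt0 ?exprn_gt0 ?divr_gt0 //; lra.
Qed.

(** Moving from [x] to [x - s *: z] with [z = x *m B] changes the form by [s ^+ 2 * b - 2 * s * a],
    where [a] is the squared norm of [z]. As [x] is a minimum, the linear term must vanish. *)
Lemma psd_isotropic {R : realFieldType} {n} {B : 'M[R]_n} {x : 'rV_n} : B^T = B ->
    (forall z : 'rV_n, 0 <= (z *m B *m z^T) 0 0) ->
  (x *m B *m x^T) 0 0 = 0 -> x *m B = 0.
Proof.
move=> symB psdB x0; apply/eqP; rewrite -mulmx_tr_eq0.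
set z := x *m B; set a : R := (z *m z^T) 0 0; pose b : R := (z *m B *m z^T) 0 0.
have a_ge0 : 0 <= a := mulmx_tr_ge0 z.
have b_ge0 : 0 <= b := psdB z.
have zBx : z *m B *m x^T = z *m z^T by rewrite -mulmxA /z trmx_mul symB.
have perturb s : 0 <= s ^+ 2 * b - 2 * s * a.
  have := psdB (x - s *: z).
  suff -> : ((x - s *: z) *m B *m (x - s *: z)^T) 0 0 = s ^+ 2 * b - 2 * s * a by [].
  have -> : (x - s *: z)^T = x^T - s *: z^T by apply/matrixP => i j; rewrite !mxE.
  rewrite !mulmxBl !mulmxBr -!scalemxAl -!scalemxAr zBx -/z.
  have entryB (C D : 'M[R]_1) : (C - D) 0 0 = C 0 0 - D 0 0 by rewrite !mxE.
  have entryZ c (C : 'M[R]_1) : (c *: C) 0 0 = c * C 0 0 by rewrite mxE.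
  rewrite !entryB !entryZ -/a -/b x0; ring.
exact/eqP/(perturbation_eq0 _ b).
Qed.

(** * The largest root of the Laplacian characteristic polynomial *)

Section Lapmax.
Context {R : rcfType} {n : nat} {e : rel 'I_n}.

Lemma lap_max_ge0 : 0 <= lap_max R e.
Proof. exact: bigmax_ge_id. Qed.

Lemma root_le_lap_max a : root (char_poly (laplacian R e)) a -> a <= lap_max R e.
Proof.
move=> ra; have p0 : char_poly (laplacian R e) != 0.
  by rewrite monic_neq0 ?char_poly_monic.
apply: (@le_bigmax_seq _ _ _ _ _ _ predT id) => //.
by rewrite -roots_on_rootsR // inE.
Qed.

(** The hypothesis [0 <= b] accounts for the default value of the maximum. *)
Lemma lap_max_le b : 0 <= b -> (forall a, root (char_poly (laplacian R e)) a -> a <= b) ->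
  lap_max R e <= b.
Proof.
move=> b0 rb; have p0 : char_poly (laplacian R e) != 0.
  by rewrite monic_neq0 ?char_poly_monic.
rewrite /lap_max big_seq; apply: bigmax_le => // a; rewrite -roots_on_rootsR //.
by rewrite inE => /rb.
Qed.

End Lapmax.

(** * Counting edges and triangles as cliques *)

Definition clique {T : finType} (e : rel T) (A : {pred T}) : bool :=
  [forall x in A, forall y in A, (x != y) ==> e x y].

Lemma cliqueP {T : finType} {e : rel T} {A : {pred T}} :
  reflect {in A &, forall x y, x != y -> e x y} (clique e A).
Proof.
apply: (iffP 'forall_in_'forall_in_implyP) => cA x; first by move=> y xA yA; apply: cA.
by move=> xA y yA; apply: cA.
Qed.

(** Grouping the tuples by their underlying set, each clique arises from its [k!] orderings. The
    cases 2 and 3 yield the factors 2 and 6 below. *)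
Lemma card_clique_tuples (T : finType) (e : rel T) k :
  #|[set u : k.-tuple T | uniq u && clique e (mem u)]|
  = (k`! * #|[set S : {set T} | (#|S| == k) && clique e S]|)%N.
Proof.
rewrite -sum1_card (partition_big (fun u : k.-tuple T => [set x in u])
   (mem [set S : {set T} | (#|S| == k) && clique e S])) /=; last first.
  move=> u; rewrite !inE => /andP[uu /cliqueP cu].
  rewrite cardsE (card_uniqP uu) size_tuple eqxx.
  by apply/cliqueP => x y; rewrite !inE; apply: cu.
rewrite (eq_bigr (fun=> k`!)) ?sum_nat_const 1?mulnC // => S.
rewrite inE => /andP[/eqP cS /cliqueP clS].
have := card_uniq_tuples k (mem S); rewrite cS ffactnn => <-.
rewrite -sum1_card; apply: eq_bigl => u.
rewrite !inE; apply/andP/andP => [[/andP[uu _] /eqP <-]|[/allP uS uu]].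
  by split=> //; apply/allP => x xu /=; rewrite inE.
(* A duplicate-free [k]-tuple with entries in a [k]-set exhausts it. *)
split; last first.
  rewrite eqEcard cS cardsE (card_uniqP uu) size_tuple leqnn andbT.
  by apply/subsetP => x; rewrite inE => /uS.
by rewrite uu /=; apply/cliqueP => x y /uS xS /uS yS; apply: clS.
Qed.

Section Counting.
Context {n : nat} {e : rel 'I_n} (e_simple : simple_graph e).

(** Both sides count ordered pairs of adjacent vertices. *)
Lemma sum_degree : (\sum_v degree e v = 2 * num_edges e)%N.
Proof.
have [symE irrE] := e_simple.
have -> : num_edges e = #|[set S : {set 'I_n} | (#|S| == 2) && clique e S]|.
  apply: eq_card => S; rewrite !inE; apply/existsP/andP.
    case=> x /existsP[y /andP[exy /eqP ->]].
    have nxy : x != y by apply: contraTneq exy => ->; rewrite irrE.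
    rewrite cards2 nxy; split=> //; apply/cliqueP => u v.
    by rewrite !inE => /orP[] /eqP-> /orP[] /eqP->; rewrite ?eqxx // symE.
  case=> /cards2P[x [y [nxy ->]]] /cliqueP cS; exists x; apply/existsP; exists y.
  by rewrite eqxx andbT; apply: cS; rewrite ?inE ?eqxx ?orbT.
rewrite -(card_clique_tuples _ e 2).
under eq_bigr do rewrite /degree -sum1dep_card.
rewrite pair_big_dep /= sum1dep_card.
rewrite -(card_imset (f := fun p : 'I_n * 'I_n => [tuple p.1; p.2])); last first.
  by move=> [a b] [c d] /(congr1 val) [-> ->].
apply: eq_card => u; rewrite inE; apply/imsetP/andP => [[[x y]]|[]].
  rewrite inE /= => exy ->; rewrite /= inE.
  have nxy : x != y by apply: contraTneq exy => ->; rewrite irrE.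
  rewrite nxy; split=> //; apply/cliqueP => a b.
  by rewrite -!topredE /= !orbF => /orP[] /eqP-> /orP[] /eqP->; rewrite ?eqxx // symE.
case/tupleP: u => x u; case/tupleP: u => y u; rewrite (tuple0 u) /= inE andbT.
move=> nxy /cliqueP cu; exists (x, y); last exact: val_inj.
by rewrite inE /=; apply: cu; rewrite // -topredE /= eqxx ?orbT.
Qed.

(** The product is the indicator of an ordered triangle. *)
Lemma sum_triangles :
  (\sum_v \sum_i \sum_j (e v i * e i j * e v j) = 6 * num_triangles e)%N.
Proof.
have [symE irrE] := e_simple.
rewrite -(card_clique_tuples _ e 3).
rewrite pair_big /= pair_big /=.
rewrite (eq_bigr (fun p : 'I_n * 'I_n * 'I_n =>
   if [&& e p.1.1 p.1.2, e p.1.2 p.2 & e p.1.1 p.2] then 1%N else 0%N)); last first.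
  by move=> [[x y] z] _ /=; case: (e x y); case: (e y z); case: (e x z).
rewrite -big_mkcond sum1dep_card.
rewrite -(card_imset
  (f := fun p : 'I_n * 'I_n * 'I_n => [tuple p.1.1; p.1.2; p.2])); last first.
  by move=> [[a b] c] [[a' b'] c'] /(congr1 val) [-> -> ->].
apply: eq_card => u; rewrite inE; apply/imsetP/andP => [[[[x y] z]]|[]].
  rewrite inE /= => /and3P[exy eyz exz] ->; rewrite /= !inE.
  have neq a b : e a b -> a != b by apply: contraTneq => ->; rewrite irrE.
  rewrite negb_or !neq //; split=> //; apply/cliqueP => a b.
  by rewrite -!topredE /= !orbF => /or3P[] /eqP-> /or3P[] /eqP->; rewrite ?eqxx // symE.
case/tupleP: u => x u; case/tupleP: u => y u; case/tupleP: u => z u.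
rewrite (tuple0 u) /= !inE negb_or andbT.
move=> /andP[/andP[nxy nxz] nyz] /cliqueP cu.
exists (x, y, z); last exact: val_inj.
by rewrite inE /=; apply/and3P; split; apply: cu; rewrite // -topredE /= eqxx ?orbT.
Qed.

End Counting.

(** * The Laplacian form and its bound by the order *)

Section Laplacian.
Context {R : rcfType} {n : nat} {e : rel 'I_n} (e_simple : simple_graph e).

Local Notation L := (laplacian R e).
Local Notation lam := (lap_max R e).
Local Notation d v := ((degree e v)%:R : R).
Local Notation a i j := ((e i j)%:R : R).
Local Notation ones := (const_mx 1 : 'rV[R]_n).

Lemma sum_adj v : \sum_j a v j = d v.
Proof.
by rewrite -natr_sum /degree -sum1dep_card [in RHS]big_mkcond /=; congr _%:R.
Qed.

Lemma adjC i j : a i j = a j i.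
Proof. by have [-> _] := e_simple. Qed.

Lemma tr_laplacian : L^T = L.
Proof.
apply/matrixP => i j; rewrite !mxE adjC [j == i]eq_sym.
by case: eqP => [->|].
Qed.

Lemma mul_laplacian (x : 'rV_n) j : (x *m L) 0 j = d j * x 0 j - \sum_i x 0 i * a i j.
Proof.
rewrite mxE (eq_bigr (fun i => x 0 i * (if i == j then d i else 0) - x 0 i * a i j)).
  rewrite sumrB (bigD1 j) //= eqxx big1 ?addr0 1?[_ * d j]mulrC // => i /negPf ->.
  exact: mulr0.
by move=> i _; rewrite !mxE mulrBr.
Qed.

Lemma ones_laplacian : ones *m L = 0.
Proof.
apply/rowP => j; rewrite mul_laplacian !mxE mulr1 -sum_adj.
by apply/eqP; rewrite subr_eq0; apply/eqP/eq_bigr => i _; rewrite mxE mul1r adjC.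
Qed.

Lemma dotmx_ones (x : 'rV[R]_n) : (x *m ones^T) 0 0 = \sum_j x 0 j.
Proof. by rewrite mxE; apply: eq_bigr => j _; rewrite !mxE mulr1. Qed.

(** Twice the form is the sum of [(x 0 i - x 0 j) ^+ 2] over adjacent ordered pairs. Extending it to
    all pairs, as in the complete graph, gives [2 * (n%:R * S2 - S1 ^+ 2)], and the square is
    dropped. *)
Lemma laplacian_form_le (x : 'rV_n) : (x *m L *m x^T) 0 0 <= n%:R * (x *m x^T) 0 0.
Proof.
pose Q := \sum_i \sum_j a i j * (x 0 i - x 0 j) ^+ 2.
pose S1 := \sum_i x 0 i; pose S2 := \sum_i x 0 i ^+ 2.
have sqrE b c : (b - c : R) ^+ 2 = b ^+ 2 + c ^+ 2 - 2 * (b * c) by ring.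
have normE : (x *m x^T) 0 0 = S2.
  by rewrite mxE; apply: eq_bigr => i _; rewrite mxE expr2.
have QE : Q = 2 * (x *m L *m x^T) 0 0.
  pose D := \sum_i d i * x 0 i ^+ 2; pose P := \sum_i \sum_j a i j * (x 0 i * x 0 j).
  have -> : (x *m L *m x^T) 0 0 = D - P.
    rewrite mxE -sumrB; apply: eq_bigr => j _.
    rewrite mul_laplacian mxE mulrBl mulr_suml expr2 mulrA; congr (_ - _).
    by apply: eq_bigr => i _; rewrite (adjC i j); ring.
  have -> : Q = D + D - 2 * P; last by ring.
  have E1 : \sum_i \sum_j a i j * x 0 i ^+ 2 = D.
    by apply: eq_bigr => i _; rewrite -mulr_suml sum_adj.
  (* One copy of [D] is summed by rows, the other by columns, to supply both squares of each
     pair. *)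
  rewrite -{1}E1 -{1}E1 [X in _ + X - _]exchange_big /= mulr_sumr -big_split -sumrB /=.
  apply: eq_bigr => i _; rewrite mulr_sumr -big_split -sumrB /=.
  by apply: eq_bigr => j _; rewrite (adjC j i) sqrE; ring.
have : Q <= 2 * (n%:R * S2 - S1 ^+ 2).
  apply: (@le_trans _ _ (\sum_i \sum_j (x 0 i - x 0 j) ^+ 2)).
    apply: ler_sum => i _; apply: ler_sum => j _; case: (e i j); rewrite ?mul1r //.
    by rewrite mul0r sqr_ge0.
  have -> : \sum_i \sum_j (x 0 i - x 0 j) ^+ 2 =
      \sum_i \sum_(j < n) x 0 i ^+ 2 + \sum_(i < n) S2 - 2 * \sum_i x 0 i * S1.
    rewrite mulr_sumr -big_split -sumrB /=; apply: eq_bigr => i _.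
    rewrite /S1 /S2 !mulr_sumr -big_split -sumrB /=.
    by apply: eq_bigr => j _; rewrite sqrE.
  under eq_bigr do rewrite sumr_const card_ord -mulr_natl.
  by rewrite -mulr_sumr -mulr_suml sumr_const card_ord -mulr_natl -/S1 -/S2; lra.
by rewrite QE normE => QS; have := sqr_ge0 S1; lra.
Qed.

(** This is the upper half of [lam = N] for multipartite graphs. *)
Lemma lap_max_le_order : lam <= n%:R.
Proof.
apply: lap_max_le => // b; rewrite -eigenvalue_root_char => /eigenvalueP[x xL x0].
have xx_gt0 : 0 < (x *m x^T) 0 0 by rewrite lt_def mulmx_tr_eq0 x0 mulmx_tr_ge0.
have := laplacian_form_le x; rewrite xL -scalemxAl [X in X <= _]mxE.
by rewrite ler_pM2r.
Qed.

Lemma shifted_laplacian_psd (x : 'rV_n) : 0 <= (x *m (lam%:M - L) *m x^T) 0 0.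
Proof.
rewrite mulmxBr mulmxBl mul_mx_scalar -scalemxAl.
rewrite [X in 0 <= X]mxE [X in 0 <= X + _]mxE [X in 0 <= _ + X]mxE subr_ge0.
by apply: rayleigh_le; [exact: tr_laplacian | exact: root_le_lap_max].
Qed.

(** * Centred neighbourhoods and the deficit identity *)

Definition centred_nbhd (v : 'I_n) : 'rV[R]_n := \row_j (a v j - d v / n%:R).

(** The scalar [l] is arbitrary because the identities hold for every [l]; only the sign requires
    [lam]. *)
Definition rayleigh_gap (l : R) (v : 'I_n) : R :=
  (centred_nbhd v *m (l%:M - L) *m (centred_nbhd v)^T) 0 0.

(** The centring disappears because [L] kills the all-ones vector. *)
Lemma centred_nbhd_laplacian v j :
  (centred_nbhd v *m L) 0 j = d j * a v j - \sum_i a v i * a i j.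
Proof.
have -> : centred_nbhd v = row v (adj_mx R e) - (d v / n%:R) *: ones.
  by apply/rowP => i; rewrite !mxE mulr1.
rewrite mulmxBl -scalemxAl ones_laplacian scaler0 subr0 mul_laplacian !mxE.
by congr (_ - _); apply: eq_bigr => i _; rewrite !mxE.
Qed.

Lemma rayleigh_gapE l v : (0 < n)%N -> rayleigh_gap l v =
  l * (d v - d v ^+ 2 / n%:R)
  - (\sum_j d j * a v j - \sum_j \sum_i a v i * a i j * a v j).
Proof.
move=> n_gt0; have n_neq0 : n%:R != 0 :> R by rewrite pnatr_eq0 -lt0n.
have aa j : a v j * a v j = a v j by case: (e v j); rewrite ?mulr0 ?mulr1.
rewrite /rayleigh_gap mulmxBr mulmxBl mul_mx_scalar -scalemxAl.
rewrite [LHS]mxE [X in X + _]mxE [X in _ + X]mxE; congr (l * _ - _).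
  rewrite mxE (eq_bigr (fun j => a v j - 2 * (d v / n%:R) * a v j + (d v / n%:R) ^+ 2)).
    rewrite big_split sumrB /= -mulr_sumr sum_adj sumr_const card_ord -mulr_natl.
    by field.
  by move=> j _; rewrite !mxE -[X in X - _ + _]aa; ring.
(* The image of [L] is orthogonal to the all-ones vector, so the right-hand factor may be uncentred
   as well. *)
have L1 : \sum_j (centred_nbhd v *m L) 0 j = 0.
  rewrite -dotmx_ones -mulmxA -[L]tr_laplacian -trmx_mul ones_laplacian trmx0.
  by rewrite mulmx0 mxE.
transitivity (\sum_j (centred_nbhd v *m L) 0 j * a v j).
  rewrite mxE (eq_bigr (fun j => (centred_nbhd v *m L) 0 j * a v j -
       (centred_nbhd v *m L) 0 j * (d v / n%:R))).
    by rewrite sumrB -mulr_suml L1 mul0r subr0.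
  by move=> j _; rewrite [X in _ * X]mxE [X in _ * X]mxE mulrBr.
rewrite -sumrB; apply: eq_bigr => j _.
by rewrite centred_nbhd_laplacian mulrBl -mulrA aa mulr_suml.
Qed.

Local Notation m := ((num_edges e)%:R : R).
Local Notation t := ((num_triangles e)%:R : R).
Local Notation N := (n%:R : R).

Lemma sum_degreeR : \sum_v d v = 2 * m.
Proof. by rewrite -natr_sum (sum_degree e_simple) natrM. Qed.

Lemma sum_rayleigh_gap l : (0 < n)%N ->
  \sum_v rayleigh_gap l v =
    l * (2 * m - (\sum_v d v ^+ 2) / N) - (\sum_v d v ^+ 2 - 6 * t).
Proof.
move=> n_gt0; under eq_bigr do rewrite rayleigh_gapE //.
rewrite sumrB -mulr_sumr !sumrB sum_degreeR -mulr_suml; congr (_ - (_ - _)).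
  rewrite exchange_big; apply: eq_bigr => j _ /=; rewrite -mulr_sumr expr2.
  by congr (_ * _); rewrite -sum_adj; apply: eq_bigr => v _; rewrite adjC.
rewrite -natrM -(sum_triangles e_simple) natr_sum; apply: eq_bigr => v _.
rewrite exchange_big natr_sum; apply: eq_bigr => i _.
by rewrite natr_sum; apply: eq_bigr => j _; rewrite !natrM.
Qed.

Definition degree_variance : R := \sum_v (d v - 2 * m / N) ^+ 2.

Lemma degree_varianceE : (0 < n)%N ->
  degree_variance = \sum_v d v ^+ 2 - 4 * m ^+ 2 / N.
Proof.
move=> n_gt0; have n_neq0 : N != 0 by rewrite pnatr_eq0 -lt0n.
rewrite /degree_variance
  (eq_bigr (fun v => d v ^+ 2 - 4 * m / N * d v + (2 * m / N) ^+ 2)).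
  rewrite big_split sumrB /= -mulr_sumr sum_degreeR sumr_const card_ord -mulr_natl.
  by field.
by move=> v _; ring.
Qed.

(** The variance term is chosen so that the sum of the squared degrees, which the bound does not
    contain, cancels. *)
Lemma deficitE l : (0 < n)%N ->
  2 * (l * (m * (N ^+ 2 - 2 * m)) - (2 * m ^+ 2 - 3 * N * t) * N) =
  N ^+ 2 * (\sum_v rayleigh_gap l v) + N * degree_variance * (l + N).
Proof.
move=> n_gt0; have n_neq0 : N != 0 by rewrite pnatr_eq0 -lt0n.
by rewrite sum_rayleigh_gap // degree_varianceE //; field.
Qed.

(** * The inequality and its equality case *)

Context (m_gt0 : (1 <= num_edges e)%N).

Lemma order_gt0 : (0 < n)%N.
Proof.
move: m_gt0; rewrite -(ltn_pmul2l (isT : 0 < 2)%N) -(sum_degree e_simple).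
by case: n e => // e'; rewrite big_ord0.
Qed.

(** No vertex is its own neighbour, so every degree is at most [n - 1], and summing gives
    [2 * m + N <= N ^+ 2]. *)
Lemma denominator_gt0 : 0 < m * (N ^+ 2 - 2 * m).
Proof.
have n_gt0 := order_gt0; rewrite mulr_gt0 ?ltr0n // subr_gt0 -sum_degreeR.
have -> : N ^+ 2 = \sum_(v < n) N by rewrite sumr_const card_ord expr2 mulr_natr.
apply: (@lt_le_trans _ _ (\sum_(v < n) (d v + 1))).
  by rewrite big_split /= ltrDl sumr_const card_ord ltr0n.
apply: ler_sum => v _; rewrite natr1 ler_nat -[X in (_ <= X)%N]card_ord.
rewrite -cardsT; apply: proper_card; apply/properP; split; first exact: subsetT.
by exists v; rewrite !inE // (proj2 e_simple).
Qed.

Lemma rayleigh_gap_ge0 v : 0 <= rayleigh_gap lam v.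
Proof. exact: shifted_laplacian_psd. Qed.

Lemma degree_variance_ge0 : 0 <= degree_variance.
Proof. by apply: sumr_ge0 => v _; apply: sqr_ge0. Qed.

Lemma degree_variance_eq0 v : degree_variance = 0 -> d v = 2 * m / N.
Proof.
move=> /psumr_eq0P V0; apply/eqP; rewrite -subr_eq0 -sqrf_eq0.
by rewrite V0 // => i _; apply: sqr_ge0.
Qed.

Lemma bound_le : (2 * m ^+ 2 - 3 * N * t) / (m * (N ^+ 2 - 2 * m)) * N <= lam.
Proof.
have n_gt0 := order_gt0; have D_gt0 := denominator_gt0.
rewrite mulrAC ler_pdivrMr // -subr_ge0 -(pmulr_rge0 _ (ltr0n R 2)) deficitE //.
have gaps : 0 <= \sum_v rayleigh_gap lam v.
  by apply: sumr_ge0 => v _; apply: rayleigh_gap_ge0.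
by rewrite addr_ge0 ?mulr_ge0 ?addr_ge0 ?sqr_ge0 ?lap_max_ge0 ?degree_variance_ge0.
Qed.

(** The deficit is a sum of nonnegative terms with positive coefficients, so it vanishes only if
    each term does. *)
Lemma bound_eqP :
  lam = (2 * m ^+ 2 - 3 * N * t) / (m * (N ^+ 2 - 2 * m)) * N <->
  (forall v, rayleigh_gap lam v = 0) /\ degree_variance = 0.
Proof.
have n_gt0 := order_gt0; have D_gt0 := denominator_gt0.
have N_gt0 : 0 < N by rewrite ltr0n.
have -> : (lam = (2 * m ^+ 2 - 3 * N * t) / (m * (N ^+ 2 - 2 * m)) * N) <->
  (N ^+ 2 * (\sum_v rayleigh_gap lam v) + N * degree_variance * (lam + N) == 0).
  rewrite mulrAC -deficitE // mulf_eq0 pnatr_eq0 /= subr_eq0.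
  by split=> [->|/eqP <-]; rewrite ?divfK ?mulfK ?(gt_eqF D_gt0).
have gaps : 0 <= \sum_v rayleigh_gap lam v.
  by apply: sumr_ge0 => v _; apply: rayleigh_gap_ge0.
have lamN : 0 < lam + N by rewrite ltr_wpDl ?lap_max_ge0.
rewrite paddr_eq0 ?mulr_ge0 ?sqr_ge0 ?degree_variance_ge0 ?(ltW lamN) ?(ltW N_gt0) //.
rewrite !mulf_eq0 !(gt_eqF N_gt0) (gt_eqF lamN) !orbF /=.
rewrite psumr_eq0 => [|v _]; last exact: rayleigh_gap_ge0.
split=> [/andP[/allP g0 /eqP V0]|[g0 ->]].
  by split=> // v; apply/eqP/g0; rewrite mem_index_enum.
by rewrite eqxx andbT; apply/allP => v _; rewrite g0 eqxx.
Qed.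

Lemma tight_gap_eigen v : rayleigh_gap lam v = 0 ->
  centred_nbhd v *m L = lam *: centred_nbhd v.
Proof.
move=> /(psd_isotropic _ shifted_laplacian_psd).
have -> : (lam%:M - L)^T = lam%:M - L by rewrite linearB /= tr_scalar_mx tr_laplacian.
move=> /(_ (erefl _)) /eqP.
by rewrite mulmxBr mul_mx_scalar subr_eq0 eq_sym => /eqP.
Qed.

Lemma tight_multipartite :
  (forall v, rayleigh_gap lam v = 0) -> degree_variance = 0 ->
  regular_complete_multipartite e.
Proof.
move=> gap0 V0; have n_gt0 := order_gt0; have [symE irrE] := e_simple.
have N_neq0 : N != 0 by rewrite pnatr_eq0 -lt0n.
have eigen v j : d j * a v j - \sum_i a v i * a i j = lam * (a v j - d v / N).
  by rewrite -centred_nbhd_laplacian tight_gap_eigen // !mxE.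
have d_gt0 v : 0 < d v.
  by rewrite degree_variance_eq0 // divr_gt0 ?mulr_gt0 ?ltr0n.
(* The diagonal entry of the eigenvector equation reads [- d v = - lam * (d v / N)]. *)
have lamN : lam = N.
  have v : 'I_n := Ordinal n_gt0; have := eigen v v.
  rewrite irrE mulr0 !sub0r (eq_bigr (fun i => a v i)) ?sum_adj; last first.
    by move=> i _; rewrite (adjC i v); case: (e v i); rewrite ?mulr0 ?mulr1.
  rewrite mulrN => /oppr_inj dE; have dv_neq0 : d v != 0 by rewrite gt_eqF.
  by apply: (mulIf dv_neq0); rewrite [in RHS]dE; field.
(* For non-adjacent [v] and [j] the equation says that they have [d v] common neighbours, which is
   all of the neighbours of [v]. *)
have sub_nbhd v j : ~~ e v j -> forall i, e v i -> e j i.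
  move=> /negPf nvj i evi; have := eigen v j; rewrite nvj mulr0 !sub0r mulrN lamN.
  move=> /oppr_inj; rewrite mulrCA mulfV // mulr1 -sum_adj => /esym/eqP.
  rewrite -subr_eq0 -sumrB psumr_eq0 => [|k _]; last first.
    by case: (e v k); rewrite ?mul1r ?mul0r ?subrr // subr_ge0 lern1 leq_b1.
  move=> /allP/(_ i (mem_index_enum i)) /=; rewrite evi mul1r (symE j).
  by case: (e i j) => //; rewrite subr0 oner_eq0.
pose nb x := [set y | e x y].
have nbE x y : e x y = (nb x != nb y).
  apply/idP/idP => [exy|]; last first.
    apply: contraNT => nxy; apply/eqP/setP => i; rewrite !inE.
    by apply/idP/idP; apply: sub_nbhd; rewrite // symE.
  by apply: contraTneq exy => /setP/(_ y); rewrite !inE irrE => ->.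
pose im := [set nb x | x : 'I_n].
have nb_im x : nb x \in im by apply: imset_f.
(* The parts are indexed by the distinct neighbourhoods. *)
pose f x := enum_rank_in (nb_im (Ordinal n_gt0)) (nb x).
have fE x y : (f x == f y) = (nb x == nb y).
  by apply/eqP/eqP => [/enum_rank_in_inj|]; [apply | rewrite /f => ->].
have f_onto i : exists x, f x = i.
  have /imsetP[x _ xE] := enum_valP i; exists x.
  by rewrite /f -xE enum_valK_in.
(* The part of [x] is the complement of its neighbourhood, so regularity makes the parts equal. *)
have part_size x : #|[set y | f y == f x]| = (n - degree e x)%N.
  have <- : #|~: nb x| = (n - degree e x)%N by rewrite cardsCs setCK card_ord.
  apply: eq_card => y.
  by rewrite !inE fE nbE eq_sym negbK.
exists #|im|, f; split=> [|i|i j|x y].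
- have [x xy] : exists x, 0 < d x by exists (Ordinal n_gt0).
  have [y exy] : exists y, e x y.
    by move: xy; rewrite ltr0n card_gt0 => /set0Pn[y]; rewrite inE; exists y.
  apply/card_gt1P; exists (nb x), (nb y).
  by split; rewrite ?nb_im // -nbE.
- by have [x <-] := f_onto i; apply/card_gt0P; exists x; rewrite inE eqxx.
- have [x <-] := f_onto i; have [y <-] := f_onto j; rewrite !part_size.
  congr (_ - _)%N; apply/eqP; rewrite -(eqr_nat R).
  by rewrite !(degree_variance_eq0 _ V0).
- by rewrite nbE fE.
Qed.

(** With parts of size [c] all degrees are [N - c], and each centred neighbourhood is an eigenvector
    for [N], which is then the largest eigenvalue. *)
Lemma multipartite_tight : regular_complete_multipartite e ->
  (forall v, rayleigh_gap lam v = 0) /\ degree_variance = 0.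
Proof.
move=> [k [f [_ _ eq_parts eE]]]; have n_gt0 := order_gt0.
have N_neq0 : N != 0 by rewrite pnatr_eq0 -lt0n.
pose v0 := Ordinal n_gt0; pose c : R := #|[set x | f x == f v0]|%:R.
have cE v : \sum_i (f i == f v)%:R = c.
  rewrite /c (eq_parts _ (f v)) -natr_sum -sum1dep_card [in RHS]big_mkcond.
  by congr _%:R; apply: eq_bigr => i _; case: (f i == f v).
have aE i j : a i j = 1 - (f i == f j)%:R.
  by rewrite eE; case: (f i == f j); rewrite ?subrr ?subr0.
have sum1N : \sum_(i < n) (1 : R) = N by rewrite sumr_const card_ord.
have dE v : d v = N - c.
  rewrite -sum_adj -(cE v) -sum1N -sumrB; apply: eq_bigr => i _.
  by rewrite aE eq_sym.
have V0 : degree_variance = 0.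
  have m2E : 2 * m = N * (N - c).
    by rewrite -sum_degreeR (eq_bigr _ (fun u _ => dE u)) sumr_const card_ord mulr_natl.
  by apply: big1 => v _; rewrite dE m2E mulrAC mulfV // mul1r subrr expr0n.
have eigen v : centred_nbhd v *m L = N *: centred_nbhd v.
  apply/rowP => j; rewrite centred_nbhd_laplacian !mxE mulrBr mulrCA mulfV // mulr1.
  case: (eqVneq (f v) (f j)) => [fvj|fvj].
    rewrite (eq_bigr (fun i => a v i)) ?sum_adj => [|i _].
      by rewrite eE fvj eqxx !mulr0.
    by rewrite eE [e i j]eE -fvj eq_sym; case: (_ != _); rewrite ?mulr0 ?mulr1.
  (* For [v] and [j] in different parts, the common neighbours are the vertices outside both parts,
     [N - 2 * c] in number. *)
  rewrite (eq_bigr (fun i => 1 - (f i == f v)%:R - (f i == f j)%:R)) => [|i _].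
    by rewrite !sumrB !cE sum1N !dE eE fvj /= mulr1n; ring.
  rewrite !aE [f v == _]eq_sym.
  case: (eqVneq (f i) (f v)) => [->|_]; last by rewrite subr0 mul1r.
  by rewrite (negPf fvj) /= subrr mul0r subr0.
have d_gt0 : 0 < d v0.
  by rewrite degree_variance_eq0 // divr_gt0 ?mulr_gt0 ?ltr0n.
have lamN : lam = N.
  apply/le_anti; rewrite lap_max_le_order root_le_lap_max // -eigenvalue_root_char.
  apply/eigenvalueP; exists (centred_nbhd v0) => //.
  (* The vector is nonzero because its entry at [v0] is [- d v0 / N]. *)
  apply: contraTneq d_gt0 => /rowP/(_ v0); rewrite !mxE (proj2 e_simple) sub0r.
  move=> /eqP; rewrite oppr_eq0 mulf_eq0 invr_eq0 (negPf N_neq0) orbF.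
  by move=> /eqP ->; rewrite ltxx.
split=> // v; rewrite /rayleigh_gap mulmxBr eigen lamN mul_mx_scalar subrr.
by rewrite mul0mx mxE.
Qed.

End Laplacian.

Theorem theorem2 (R : rcfType) (n : nat) (e : rel 'I_n) :
  simple_graph e -> (1 <= num_edges e)%N ->
  let m : R := (num_edges e)%:R in
  let t : R := (num_triangles e)%:R in
  let nR : R := n%:R in
  ((2 * m ^+ 2 - 3 * nR * t) / (m * (nR ^+ 2 - 2 * m)) * nR <= lap_max R e) /\
  (lap_max R e = (2 * m ^+ 2 - 3 * nR * t) / (m * (nR ^+ 2 - 2 * m)) * nR
     <-> regular_complete_multipartite e).
Proof.
move=> e_simple m_gt0 m t nR; split; first exact: bound_le.
apply: (iff_trans (bound_eqP e_simple m_gt0)); split=> [[gap0 var0]|].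
  exact: tight_multipartite gap0 var0.
exact: multipartite_tight.
Qed.
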